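(* Consider the all-batch change model described in the context, and suppose that for every batch $e\in\{1,\dots,E\}$ the post-change parameter set $\Lambda^{e}=\{\lambda:|\lambda-\theta^{(e)}|\ge\epsilon\}$ is finite (where $\epsilon>0$ is fixed). Then the stopping time $\tau_a=\inf\{n\ge1:W_n>A\}$ is asymptotically efficient. That is, there exist thresholds $A=A_\beta=O(\log\beta)$ such that, as $\beta\to\infty$, \[ \mathbb{E}_\infty[\tau_a]\ge\beta(1+o(1)), \] and there is a constant $C>0$ with \[ \mathbb{E}_1[\tau_a]\le C\log\beta\,(1+o(1)), \] whenever the change affects all batches with post-change parameters $\lambda^{(e)}\in\Lambda^e$, $e=1,\dots,E$.
   Context: Let $\{p(\cdot;\theta):\theta\in\Theta\subseteq\mathbb{R}\}$ be a parametric family of probability densities with respect to a common dominating measure. Assume that for any two distinct parameters the Kullback–Leibler divergence between the corresponding densities is finite and strictly positive. **Period and batches.** Fix a period $T\in\mathbb{N}$ and integers $0=N_0<N_1<\dots<N_E=T$. The batches are $B_e=\{N_{e-1}+1,\dots,N_e\}$ for $e=1,\dots,E$, which partition $\{1,\dots,T\}$. For $k\in\mathbb{N}$, the batch of $k$, written $b(k)$, is the unique $j$ with $r(k)\in B_j$. Here $r(k)\in\{1,\dots,T\}$ is the residue of $k$ modulo $T$, with residue $0$ identified with $T$. There are baseline (pre-change) parameters $\theta^{(1)},\dots,\theta^{(E)}$. **Pre-change model.** Under the no-change measure $\mathbb{P}_\infty$, the observations $Y_1,Y_2,\dots$ are independent with $Y_k\sim p(\cdot;\theta^{(b(k))})$.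 **All-batch change model.** For a change time $\gamma\in\mathbb{N}$ and post-change parameters $\lambda^{(1)},\dots,\lambda^{(E)}$ with $\lambda^{(e)}\ne\theta^{(e)}$, the measure $\mathbb{P}_\gamma$ makes the $Y_k$ independent with the following laws: - $Y_k\sim p(\cdot;\theta^{(b(k))})$ for $k<\gamma$; - $Y_k\sim p(\cdot;\lambda^{(b(k))})$ for $k\ge\gamma$. $\mathbb{E}_\gamma$ denotes expectation under $\mathbb{P}_\gamma$. **Statistic and stopping rule.** For $\epsilon>0$ let $\Lambda^e=\{\lambda:|\lambda-\theta^{(e)}|\ge\epsilon\}$. Define \[ W_n=\max_{1\le k\le n}\ \sup_{\lambda^{(e)}\in\Lambda^{e},\ e=1,\dots,E}\ \sum_{i=k}^{n}\log\frac{p(Y_i;\lambda^{(b(i))})}{p(Y_i;\theta^{(b(i))})}, \] and $\tau_a=\inf\{n\ge1:W_n>A\}$ for a threshold $A>0$. **Asymptotic efficiency.** A family of stopping times $\tau$ indexed by a false-alarm parameter $\beta$ is called asymptotically efficient if, as $\beta\to\infty$, $\mathbb{E}_\infty[\tau]\ge\beta(1+o(1))$, and there exists a constant $C>0$ with $\mathbb{E}_1[\tau]\le C\log\beta\,(1+o(1))$. *)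

(* Defs.v *)
From HB Require Import structures.
From mathcomp Require Import all_boot all_order all_algebra.
From mathcomp Require Import all_classical all_reals all_analysis.
Set Implicit Arguments. Unset Strict Implicit. Unset Printing Implicit Defensive.
Import Order.TTheory GRing.Theory Num.Theory.
Import numFieldNormedType.Exports.
Local Open Scope classical_set_scope.
Local Open Scope ring_scope.

Section Defs.
Context {R : realType}.

Definition is_density {dX} {X : measurableType dX}
    (mu : {measure set X -> \bar R}) (f : X -> R) : Prop :=
  measurable_fun setT f /\ (forall x, 0 <= f x) /\
  (\int[mu]_x (f x)%:E = 1)%E.

(** KL divergence KL(f || g) = \int f ln (f / g) dmu is finite and strictly
    positive: f dmu << g dmu (i.e. g > 0 mu-a.e. on {f > 0}), the integrand
    is mu-integrable, and its integral is > 0. *)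
Definition KL_finite_pos {dX} {X : measurableType dX}
    (mu : {measure set X -> \bar R}) (f g : X -> R) : Prop :=
  {ae mu, forall x, 0 < f x -> 0 < g x} /\
  mu.-integrable setT (fun x => (f x * ln (f x / g x))%:E) /\
  (0 < \int[mu]_x (f x * ln (f x / g x))%:E)%E.

Definition resid (T k : nat) : nat := if (k %% T == 0)%N then T else (k %% T)%N.

(** batch of k: the j in 1..E with N (j-1) < r(k) <= N j
    (given N 0 = 0 < r(k) and N increasing this is the first j with r(k) <= N j) *)
Definition batch (T E : nat) (N : nat -> nat) (k : nat) : nat :=
  find (fun j => resid T k <= N j)%N (iota 0 E.+1).

Definition Lambda (Theta : set R) (theta : nat -> R) (eps : R) (e : nat) : set R :=
  [set l | Theta l /\ eps <= `|l - theta e|].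

Definition llr {X : Type} (p : R -> X -> R) (la th : R) (y : X) : R :=
  ln (p la y / p th y).

Definition Wstat {X : Type} (p : R -> X -> R) (Theta : set R) (T E : nat)
    (N : nat -> nat) (theta : nat -> R) (eps : R) (y : nat -> X) (n : nat)
    : \bar R :=
  ereal_sup [set (\sum_(kl.1 <= i < n.+1)
                    llr p (kl.2 (batch T E N i)) (theta (batch T E N i)) (y i))%:E
            | kl in [set k : nat | (1 <= k <= n)%N] `*` 
                   [set lam : nat -> R | forall e, (1 <= e <= E)%N ->
                                         Lambda Theta theta eps e (lam e)]
            ]%classic.

(** tau_A = inf {n >= 1 : W_n > A}, valued in \bar R (+oo if never) *)
Definition tau {X : Type} (p : R -> X -> R) (Theta : set R) (T E : nat)
    (N : nat -> nat) (theta : nat -> R) (eps : R) (A : R) (y : nat -> X)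
    : \bar R :=
  ereal_inf [set (n%:R)%:E | n in
     [set n : nat | (1 <= n)%N /\ (A%:E < Wstat p Theta T E N theta eps y n)%E]].

Definition indep_obs {dO dX} {O : measurableType dO} {X : measurableType dX}
    (P : probability O R) (Y : nat -> O -> X) : Prop :=
  forall (F : seq nat) (B : nat -> set X),
    uniq F -> all (fun k => 1 <= k)%N F -> (forall k, measurable (B k)) ->
    P (\bigcap_(k in [set k | k \in F]) (Y k @^-1` B k)) =
    (\prod_(k <- F) P (Y k @^-1` B k))%E.

Definition obs_model {dO dX} {O : measurableType dO} {X : measurableType dX}
    (mu : {measure set X -> \bar R}) (p : R -> X -> R)
    (P : probability O R) (Y : nat -> O -> X) (param : nat -> R) : Prop :=
  (forall k, (1 <= k)%N -> measurable_fun setT (Y k)) /\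
  indep_obs P Y /\
  (forall k (B : set X), (1 <= k)%N -> measurable B ->
     P (Y k @^-1` B) = (\int[mu]_(x in B) (p (param k) x)%:E)%E).

(** parameter of observation k under P_gamma (all-batch change at gamma);
    P_infinity corresponds to using theta (batch k) for all k. *)
Definition change_param (T E : nat) (N : nat -> nat) (theta lam : nat -> R)
    (gamma k : nat) : R :=
  if (k < gamma)%N then theta (batch T E N k) else lam (batch T E N k).

End Defs.

(* Main.v *)
(** Take the threshold [A = 3 ln beta]. As a bound of the form [O(log beta)]
    is all that is asked of [A], crude estimates suffice.

    No change: each partial sum [S] of log-likelihood ratios has
    [E[exp S] <= 1], so it exceeds [A] with probability at most [exp (- A)].
    Up to time [n] there are at most [n^2 M] such sums, [M] being the number
    of choices of one post-change parameter per batch; with [n] about [beta],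
    the union bound gives [E[tau] >= n (1 - n^2 M beta^-3)].

    Change at time [1]: let [rho < 1] be the largest Hellinger affinity
    between a baseline density and an admissible post-change density of the
    same batch. The sum [S_n] along the true parameters has
    [E[exp (- S_n / 2)] <= rho^n], hence [P(S_n <= A) <= exp (A / 2) rho^n],
    and [tau] is at most the number of [n >= 0] with [S_n <= A]. Positivity
    of the Kullback-Leibler divergences enters only through [rho < 1]. *)

Require Import Defs.
From HB Require Import structures.
From mathcomp Require Import all_boot all_order all_algebra.
From mathcomp Require Import all_classical all_reals all_analysis.
From mathcomp Require Import measurable_realfun ring lra.
Import Order.TTheory GRing.Theory Num.Theory.
Import numFieldNormedType.Exports.
Local Open Scope classical_set_scope.
Local Open Scope ring_scope.

(** * Integrals of nonnegative functions, measurable or not *)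

Section integration.
Context {R : realType} {dO dX : measure_display}
  {O : measurableType dO} {X : measurableType dX}.
Local Open Scope ereal_scope.
Import HBNNSimple.

(** The integral of a nonnegative function is a supremum over the simple functions below it, so
    monotonicity survives without measurability. This serves for [tau], whose measurability is never
    established. *)
Lemma ge0_le_integral_nonmeasurable (m : {measure set O -> \bar R})
    (f g : O -> \bar R) :
  (forall x, 0 <= f x) -> (forall x, f x <= g x) ->
  \int[m]_x f x <= \int[m]_x g x.
Proof.
move=> f0 fg; have g0 x : 0 <= g x := le_trans (f0 x) (fg x).
rewrite !ge0_integralTE//; apply: ge_ereal_sup => _ [h hf <-].
by apply: ereal_sup_ubound; exists h => // x; rewrite (le_trans (hf x)).
Qed.

(** The right-hand side sees [Y] and [g] only through integrals of [g] over preimages under [Y]. It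
    comes from monotone convergence along simple approximations of [f]. *)
Lemma integral_weighted_comp_lim (m : {measure set O -> \bar R}) (Y : O -> X)
    (g : O -> R) (f : X -> R)
    (mf : measurable_fun [set: X] (EFin \o f : X -> \bar R)) :
  measurable_fun setT Y -> measurable_fun setT g ->
  (forall w, (0 <= g w)%R) -> (forall x, (0 <= f x)%R) ->
  let h := nnsfun_approx measurableT mf in
  \int[m]_w (g w * f (Y w))%:E =
  limn (fun n => \sum_(r \in range (h n))
    (r%:E * \int[m]_(w in Y @^-1` (h n @^-1` [set r])) (g w)%:E)).
Proof.
move=> mY mg g0 f0 h.
have mhY n : measurable_fun setT (h n \o Y) by exact: measurableT_comp.
transitivity (limn (fun n => \int[m]_w (g w * h n (Y w))%:E)).
  rewrite -monotone_convergence//.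
  - apply: eq_integral => w _; apply/esym/cvg_lim => //.
    under eq_fun do rewrite EFinM.
    rewrite EFinM; apply: cvgeZl => //.
    by apply: (@cvg_nnsfun_approx _ _ _ _ measurableT _ mf) => // x _;
      rewrite lee_fin.
  - by move=> n; apply/measurable_EFinP; apply: measurable_funM => //; exact: mhY.
  - by move=> n w _; rewrite lee_fin mulr_ge0.
  - move=> w _ a b ab; rewrite lee_fin ler_wpM2l//.
    exact/lefP/nd_nnsfun_approx.
congr (limn _); apply/funext => n.
have mhr r : measurable (Y @^-1` (h n @^-1` [set r])).
  by rewrite -[X in measurable X]setTI; exact: mY.
have r0 r : (h n @^-1` [set r]) !=set0 -> (0 <= r)%R.
  by move=> [x /= <-].
transitivity (\int[m]_w \sum_(r \in range (h n))
    (r * (g w * \1_(Y @^-1` (h n @^-1` [set r])) w))%:E).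
  apply: eq_integral => w _; rewrite [in LHS]fimfunE fsumEFin//; congr EFin.
  rewrite !fsbig_finite//= mulr_sumr.
  by apply: eq_bigr => r _; rewrite mulrCA.
(* A negative [r] labels an empty level set, so its indicator vanishes. *)
have nneg r w : (0 <= r * (g w * \1_(Y @^-1` (h n @^-1` [set r])) w))%R.
  rewrite indicE; have [/set_mem hr|_] := boolP (_ \in _); last by rewrite !mulr0.
  by rewrite mulr1 mulr_ge0// r0//; exists (Y w).
have mi r : measurable_fun setT
    (fun w => g w * \1_(Y @^-1` (h n @^-1` [set r])) w)%R.
  exact: measurable_funM.
rewrite ge0_integral_fsum//; last 2 first.
- by move=> r; apply/measurable_EFinP; exact: measurable_funM.
- by move=> r w _; rewrite lee_fin.
apply: eq_fsbigr => r rh.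
have r_ge0 : (0 <= r)%R by case: (set_mem rh) => x _ <-.
under eq_integral do rewrite EFinM.
rewrite ge0_integralZl//; last 2 first.
- exact/measurable_EFinP.
- by move=> w _; rewrite lee_fin mulr_ge0// indicE.
congr (_ * _); rewrite [RHS]integral_mkcond; apply: eq_integral => w _.
by rewrite patchE indicE; case: (_ \in _); rewrite ?mulr1 ?mulr0.
Qed.

End integration.

(** * Expectation of a product of functions of independent observations *)

Section independence.
Context {R : realType} {dO dX : measure_display}
  {O : measurableType dO} {X : measurableType dX}.
Local Open Scope ereal_scope.
Import HBNNSimple.

(* Both sides integrate [f] against the same measure on [X]: the image under
   [Y] of the measure with density [g], and the measure with density [q]. *)
Lemma integral_weighted_comp (m : {measure set O -> \bar R})
    (mu : {measure set X -> \bar R}) (Y : O -> X)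
    (g : O -> R) (q f : X -> R) :
  measurable_fun setT Y -> measurable_fun setT g -> measurable_fun setT q ->
  measurable_fun setT f ->
  (forall w, (0 <= g w)%R) -> (forall x, (0 <= q x)%R) ->
  (forall x, (0 <= f x)%R) ->
  (forall B, measurable B ->
    \int[m]_(w in Y @^-1` B) (g w)%:E = \int[mu]_(x in B) (q x)%:E) ->
  \int[m]_w (g w * f (Y w))%:E = \int[mu]_x (q x * f x)%:E.
Proof.
move=> mY mg mq mf g0 q0 f0 gq.
have mEf : measurable_fun [set: X] (EFin \o f : X -> \bar R) by exact/measurable_EFinP.
rewrite (integral_weighted_comp_lim _ _ _ _ mEf)//.
rewrite (integral_weighted_comp_lim mu id q f mEf)//.
by congr (limn _); apply/funext => n; apply: eq_fsbigr => r _; rewrite gq.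
Qed.

Lemma measurable_bigcap_preimage (Y : nat -> O -> X) (t : seq nat)
    (B : nat -> set X) :
  (forall k, (1 <= k)%N -> measurable_fun setT (Y k)) ->
  all (fun k => 1 <= k)%N t -> (forall k, measurable (B k)) ->
  measurable (\bigcap_(k in [set k | k \in t]) (Y k @^-1` B k)).
Proof.
move=> mY t1 mB; apply: bigcap_measurableType => k /= kt.
by rewrite -[X in measurable X]setTI; apply: mY => //; exact: (allP t1).
Qed.

(* The factors are turned from events into functions one index at a time, so
   the induction carries an arbitrary event on the remaining indices. *)
Lemma indep_obs_integral_prod_setI (P : probability O R) (Y : nat -> O -> X)
    (mu : {measure set X -> \bar R}) (q f : nat -> X -> R) (c : nat -> R) :
  (forall k, (1 <= k)%N -> measurable_fun setT (Y k)) ->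
  indep_obs P Y ->
  (forall k B, (1 <= k)%N -> measurable B ->
     P (Y k @^-1` B) = \int[mu]_(x in B) (q k x)%:E) ->
  (forall k, (1 <= k)%N -> measurable_fun setT (q k)) ->
  (forall k, (1 <= k)%N -> measurable_fun setT (f k)) ->
  (forall k x, (1 <= k)%N -> (0 <= q k x)%R) ->
  (forall k x, (0 <= f k x)%R) ->
  (forall k, (1 <= k)%N -> \int[mu]_x (q k x * f k x)%:E = (c k)%:E) ->
  forall (s t : seq nat) (B : nat -> set X), uniq (s ++ t) ->
    all (fun k => 1 <= k)%N (s ++ t) -> (forall k, measurable (B k)) ->
    \int[P]_(w in \bigcap_(k in [set k | k \in t]) (Y k @^-1` B k))
       (\prod_(k <- s) f k (Y k w))%:E =
    (\prod_(k <- s) c k)%:E * P (\bigcap_(k in [set k | k \in t]) (Y k @^-1` B k)).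
Proof.
move=> mY indep law mq mf q0 f0 fc.
elim=> [|j s IH] t B /= uqst st1 mB.
  under eq_integral do rewrite big_nil.
  by rewrite integral_cst ?big_nil//; exact: measurable_bigcap_preimage.
have /andP[jst uqst'] := uqst; have /andP[j1 st1'] := st1.
have pm : perm_eq (s ++ j :: t) (j :: s ++ t) by rewrite -cat1s perm_catCA.
have /andP[s1 t1] : all (fun k => 1 <= k)%N s && all (fun k => 1 <= k)%N t.
  by rewrite -all_cat.
set D := \bigcap_(k in _) _.
have mD : measurable D by exact: measurable_bigcap_preimage.
have PDfin : P D \is a fin_num by exact: fin_num_measure.
pose g w := (\prod_(k <- s) f k (Y k w) * \1_D w)%R.
have c0 k : (1 <= k)%N -> (0 <= c k)%R.
  move=> k1; rewrite -lee_fin -fc//; apply: integral_ge0 => x _.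
  by rewrite lee_fin mulr_ge0// q0.
have C0 : (0 <= \prod_(k <- s) c k)%R.
  by rewrite big_seq; apply: prodr_ge0 => k ks; apply/c0/(allP s1).
(* [C] is the claimed integral of [g]. Independence will show that, weighted by [g], [Y j] has
   density [C * q j]. *)
pose C := (\prod_(k <- s) c k * fine (P D))%R.
have C_ge0 : (0 <= C)%R by rewrite mulr_ge0// fine_ge0.
have mprod : measurable_fun setT (fun w => \prod_(k <- s) f k (Y k w))%R.
  apply: measurable_prod => k ks; have k1 := allP s1 _ ks.
  by apply: measurableT_comp; [exact: mf|exact: mY].
transitivity (\int[P]_w (g w * f j (Y j w))%:E).
  rewrite integral_mkcond; apply: eq_integral => w _.
  rewrite patchE /g indicE big_cons; case: (_ \in _) => /=.
    by rewrite mulr1 mulrC.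
  by rewrite mulr0 mul0r.
rewrite (integral_weighted_comp P mu _ _ (fun x => C * q j x)%R)//.
- under eq_integral do rewrite -mulrA EFinM.
  rewrite ge0_integralZl//.
  + by rewrite fc// big_cons -EFinM /C -[in RHS](fineK PDfin) -EFinM; congr EFin; ring.
  + by apply/measurable_EFinP/measurable_funM; [exact: mq|exact: mf].
  + by move=> x _; rewrite lee_fin mulr_ge0// q0.
- exact: mY.
- by apply: measurable_funM => //; exact: measurable_indic.
- by apply: measurable_funM => //; exact: mq.
- exact: mf.
- by move=> w; rewrite mulr_ge0//; apply: prodr_ge0.
- by move=> x; rewrite mulr_ge0// q0.
move=> A mA.
(* The event that [Y j] lies in [A] joins those indexed by [t], so that the induction hypothesis
   applies to [j :: t]; as [j] is not in [t], the other events stay intact. *)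
pose B' k := if k == j then A else B k.
have tB' : \bigcap_(k in [set k | k \in t]) (Y k @^-1` B' k) = D.
  apply: eq_bigcapr => k /= kt; rewrite /B'; case: eqP => // kj.
  by move: jst; rewrite -kj mem_cat kt orbT.
have jtB' : \bigcap_(k in [set k | k \in j :: t]) (Y k @^-1` B' k) =
    Y j @^-1` A `&` D.
  rewrite -tB'; apply/seteqP; split=> w /=.
    move=> h; split; first by have := h j (mem_head _ _); rewrite /B' eqxx.
    by move=> k /= kt; apply: h; rewrite /= inE kt orbT.
  move=> [jA h] k /=; rewrite inE => /orP[/eqP ->|kt]; last exact: h.
  by rewrite /B' eqxx.
have mB' k : measurable (B' k) by rewrite /B'; case: ifP.
transitivity (\int[P]_(w in Y j @^-1` A `&` D) (\prod_(k <- s) f k (Y k w))%:E).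
  rewrite integral_mkcondr; apply: eq_integral => w _.
  by rewrite patchE /g indicE; case: (_ \in _); rewrite ?mulr1 ?mulr0.
rewrite -jtB' IH//; last 2 first.
- by rewrite (perm_uniq pm).
- by rewrite (perm_all _ pm).
rewrite indep//; last 2 first.
- by have := perm_uniq pm; rewrite cat_uniq /= uqst => /and3P[].
- by rewrite /= j1.
rewrite big_cons {1}/B' eqxx law//.
under [RHS]eq_integral do rewrite EFinM.
rewrite ge0_integralZl//; last 2 first.
- by apply/measurable_EFinP; apply: measurable_funTS; exact: mq.
- by move=> x _; rewrite lee_fin q0.
rewrite /C EFinM fineK// -tB' [in RHS]indep//; last first.
  by move: uqst'; rewrite cat_uniq => /and3P[].
by rewrite -muleA; congr (_ * _); rewrite muleC.
Qed.

(** This is the case of no event: the intersection over the empty list is the whole space. *)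
Lemma indep_obs_integral_prod (P : probability O R) (Y : nat -> O -> X)
    (mu : {measure set X -> \bar R}) (q f : nat -> X -> R) (c : nat -> R) :
  (forall k, (1 <= k)%N -> measurable_fun setT (Y k)) ->
  indep_obs P Y ->
  (forall k B, (1 <= k)%N -> measurable B ->
     P (Y k @^-1` B) = \int[mu]_(x in B) (q k x)%:E) ->
  (forall k, (1 <= k)%N -> measurable_fun setT (q k)) ->
  (forall k, (1 <= k)%N -> measurable_fun setT (f k)) ->
  (forall k x, (1 <= k)%N -> (0 <= q k x)%R) ->
  (forall k x, (0 <= f k x)%R) ->
  (forall k, (1 <= k)%N -> \int[mu]_x (q k x * f k x)%:E = (c k)%:E) ->
  forall s : seq nat, uniq s -> all (fun k => 1 <= k)%N s ->
  \int[P]_w (\prod_(k <- s) f k (Y k w))%:E = (\prod_(k <- s) c k)%:E.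
Proof.
move=> mY indep law mq mf q0 f0 fc s us s1.
have := indep_obs_integral_prod_setI _ _ _ _ _ _ mY indep law mq mf q0 f0 fc
  s [::] (fun=> setT).
rewrite (_ : [set k | k \in [::]] = set0) ?bigcap_set0; last first.
  by apply/seteqP; split.
by rewrite cats0 probability_setT mule1; apply.
Qed.

End independence.

(** * Likelihood ratios and Hellinger affinity *)

Section densities.
Context {R : realType} {dX : measure_display} {X : measurableType dX}.
Variable mu : {measure set X -> \bar R}.
Implicit Types f g : X -> R.

Lemma measurable_ln_ratio f g : measurable_fun setT f -> measurable_fun setT g ->
  (forall x, 0 <= g x) -> measurable_fun setT (fun x => ln (f x / g x)).
Proof.
move=> mf mg g0; apply: measurableT_comp => //.
under eq_fun do rewrite -powR_inv1//.
apply: measurable_funM => //.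
by apply: (measurableT_comp (measurable_powR _)).
Qed.

(** The conventions [0^-1 = 0] and [ln 0 = 0] keep the identity true when an argument vanishes. *)
Lemma ln_ratioN (a b : R) : 0 <= a -> 0 <= b -> ln (b / a) = - ln (a / b).
Proof.
have l0 := ln0 (lexx (0 : R)).
rewrite !le_eqVlt => /predU1P[<-|a0] /predU1P[<-|b0];
  rewrite ?invr0 ?mulr0 ?mul0r ?l0 ?oppr0//.
by rewrite !ln_div ?posrE// opprB.
Qed.

(** Almost everywhere the integrand is [g] where [f > 0] and [0] elsewhere; [g] may carry mass where
    [f] vanishes, whence only an inequality. *)
Lemma integral_expR_ln_ratio_le1 f g : is_density mu f -> is_density mu g ->
  {ae mu, forall x, 0 < f x -> 0 < g x} ->
  (\int[mu]_x (f x * expR (ln (g x / f x)))%:E <= 1)%E.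
Proof.
move=> [mf [f0 _]] [mg [g0 <-]] fg.
apply: ae_ge0_le_integral => //.
- by move=> x _; rewrite lee_fin mulr_ge0// expR_ge0.
- apply/measurable_EFinP; apply: measurable_funM => //.
  by apply: measurableT_comp => //; exact: measurable_ln_ratio.
- by move=> x _; rewrite lee_fin.
- exact/measurable_EFinP.
apply: filterS fg => x fg _; rewrite lee_fin.
have := f0 x; rewrite le_eqVlt => /predU1P[<-|fx0]; first by rewrite mul0r.
by rewrite lnK ?posrE ?divr_gt0 ?fg// mulrC divfK// gt_eqF.
Qed.

(* Hellinger affinity: if it were [1], then [f (1 - sqrt (g / f))^2] would
   integrate to [0], so that [f ln (f / g)] would vanish almost everywhere. *)
Lemma integral_expR_half_ln_ratio_lt1 f g :
  is_density mu f -> is_density mu g -> KL_finite_pos mu f g ->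
  (\int[mu]_x (f x * expR (- (ln (f x / g x) / 2)))%:E < 1)%E.
Proof.
move=> df dg [fg [_ KLpos]].
have [mf [f0 f1]] := df; have [mg [g0 _]] := dg.
rewrite ltNge; apply/negP => ge1.
pose u x := expR (- (ln (f x / g x) / 2)).
have mu_ : measurable_fun setT u.
  apply: measurableT_comp => //; apply: measurableT_comp => //.
  by apply: measurable_funM => //; exact: measurable_ln_ratio.
have u0 x : 0 <= u x by exact: expR_ge0.
have m1u : measurable_fun setT (fun x => f x * (1 - u x) ^+ 2).
  by apply: measurable_funM => //; apply: measurable_funX; exact: measurable_funB.
have mfu : measurable_fun setT (fun x => f x * u x) by exact: measurable_funM.
have mfu2 : measurable_fun setT (fun x => f x * u x ^+ 2).
  by apply: measurable_funM => //; exact: measurable_funX.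
(* The identity [f (1 - u)^2 + 2 f u = f + f u^2], integrated in a form free of subtraction because
   the integrals are extended reals. *)
have sum_eq : (\int[mu]_x (f x * (1 - u x) ^+ 2)%:E +
    (\int[mu]_x (f x * u x)%:E + \int[mu]_x (f x * u x)%:E) =
    \int[mu]_x (f x)%:E + \int[mu]_x (f x * u x ^+ 2)%:E)%E.
  have fu0 x : [set: X] x -> (0 <= (f x * u x)%:E)%E.
    by move=> _; rewrite lee_fin mulr_ge0.
  have f1u0 x : [set: X] x -> (0 <= (f x * (1 - u x) ^+ 2)%:E)%E.
    by move=> _; rewrite lee_fin mulr_ge0// sqr_ge0.
  have fu20 x : [set: X] x -> (0 <= (f x * u x ^+ 2)%:E)%E.
    by move=> _; rewrite lee_fin mulr_ge0// sqr_ge0.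
  rewrite -!ge0_integralD//; try exact/measurable_EFinP.
  - by apply: eq_integral => x _; rewrite -!EFinD; congr EFin; ring.
  - by move=> x _; rewrite lee_fin.
  - by move=> x _; rewrite adde_ge0// fu0.
  - by apply: emeasurable_funD; exact/measurable_EFinP.
have fu2 : (\int[mu]_x (f x * u x ^+ 2)%:E <= 1)%E.
  apply: le_trans (integral_expR_ln_ratio_le1 _ _ df dg fg).
  rewrite le_eqVlt; apply/orP; left; apply/eqP; apply: eq_integral => x _.
  rewrite ln_ratioN// /u expr2 -expRD; congr (_ * expR _)%:E.
  by rewrite -opprD -splitr.
have int0 : (\int[mu]_x `|(f x * (1 - u x) ^+ 2)%:E| = 0)%E.
  rewrite (eq_integral (fun x => (f x * (1 - u x) ^+ 2)%:E)); last first.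
    by move=> x _; rewrite gee0_abs// lee_fin mulr_ge0// sqr_ge0.
  apply/eqP; rewrite eq_le; apply/andP; split; last first.
    by apply: integral_ge0 => x _; rewrite lee_fin mulr_ge0 ?sqr_ge0.
  (* The affinity being at least [1], [sum_eq] bounds the integral plus [1 + 1] by [1 + 1]. *)
  rewrite -(leeD2rE (x := (1 + 1)%E))// add0e.
  apply: (@le_trans _ _ (\int[mu]_x (f x * (1 - u x) ^+ 2)%:E +
    (\int[mu]_x (f x * u x)%:E + \int[mu]_x (f x * u x)%:E))%E).
    by rewrite leeD2l// leeD.
  by rewrite sum_eq f1 leeD2l.
have /(ae_eq_integral_abs _ measurableT) : measurable_fun [set: X]
    (fun x => (f x * (1 - u x) ^+ 2)%:E) by exact/measurable_EFinP.
move=> /(_ mu)[/(_ int0) ae0 _].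
move: KLpos; rewrite (ae_eq_integral (cst 0%E))// ?integral0 ?ltxx//.
  apply/measurable_EFinP; apply: measurable_funM => //.
  exact: measurable_ln_ratio.
(* At almost every point [f = 0] or [u = 1]; either makes [f ln (f / g)] vanish, against [KLpos]. *)
apply: filterS ae0 => x /(_ Logic.I) /= -[] /eqP.
rewrite mulf_eq0 => /orP[/eqP->|]; first by rewrite mul0r.
rewrite sqrf_eq0 subr_eq0 eq_sym /u => /eqP; rewrite -[RHS]expR0 => /expR_inj.
move=> z0;   have -> : ln (f x / g x) = 0 by lra.
by rewrite mulr0.
Qed.

End densities.

(** * Batches and finite selections of parameters *)

Lemma batch_bounds (T E : nat) (N : nat -> nat) (k : nat) :
  (0 < T)%N -> N 0%N = 0%N -> N E = T -> (1 <= batch T E N k <= E)%N.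
Proof.
move=> T0 N0 NE.
have r0 : (0 < resid T k)%N by rewrite /resid; case: eqP => // /eqP; rewrite lt0n.
have rT : (resid T k <= T)%N.
  by rewrite /resid; case: eqP => // _; rewrite ltnW// ltn_mod.
apply/andP; split; rewrite /batch.
  (* Index [0] fails the test of [find], since [N 0 = 0] lies below every residue. *)
  by rewrite /= N0 (leqNgt (resid T k)) r0.
have hasE : has (fun j => resid T k <= N j)%N (iota 0 E.+1).
  by apply/hasP; exists E; [rewrite mem_iota add0n ltnSn|rewrite NE].
by move: hasE; rewrite has_find size_iota ltnS.
Qed.

(** A selection is a function on all of [nat] with free values outside [1..E], so finiteness is
    meant up to agreement on [1..E]. The length of the list is the factor [M] of the union bound. *)
Lemma finite_selections (V : pointedType) (L : nat -> set V) (E : nat) :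
  (forall e, (1 <= e <= E)%N -> finite_set (L e)) ->
  exists s : seq (nat -> V),
    (forall l, l \in s -> forall e, (1 <= e <= E)%N -> L e (l e)) /\
    (forall l, (forall e, (1 <= e <= E)%N -> L e (l e)) ->
       exists2 l', l' \in s & forall e, (1 <= e <= E)%N -> l' e = l e).
Proof.
elim: E => [|E IH] finL.
  exists [:: fun=> point]; split=> [l _ e|l _].
    by case: e.
  by exists (fun=> point); [rewrite mem_head|case].
have /IH[s [sL Ls]] : forall e, (1 <= e <= E)%N -> finite_set (L e).
  by move=> e /andP[e1 eE]; apply: finL; rewrite e1 ltnW.
have /finite_seqP[r LE] : finite_set (L E.+1) by apply: finL; rewrite ltnSn.
pose ext x (l : nat -> V) e := if e == E.+1 then x else l e.
exists [seq ext x l | x <- r, l <- s];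
  split=> [_ /allpairsP[[x l] [/= xr ls ->]] e|l lL].
  rewrite /ext; case: eqVneq => [-> _|neE /andP[e1 eE]]; first by rewrite LE.
  by apply: sL => //; rewrite e1 -ltnS ltn_neqAle neE.
have [|l' l's l'l] := Ls l.
  by move=> e /andP[e1 eE]; apply: lL; rewrite e1 ltnW.
exists (ext (l E.+1) l').
  apply/allpairsP; exists (l E.+1, l'); split=> //=.
  have : L E.+1 (l E.+1) by apply: lL; rewrite ltnSn.
  by rewrite LE.
move=> e /andP[e1 eE]; rewrite /ext; case: eqVneq => [->//|neE].
by rewrite l'l// e1 -ltnS ltn_neqAle neE.
Qed.

(** * Tail bounds, union bound and geometric series *)

Section probability_bounds.
Context {R : realType} {dO : measure_display} {O : measurableType dO}.
Variable P : probability O R.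

(** Markov's inequality for the exponential of [S]. *)
Lemma chernoff_bound (S : O -> R) (c a : R) : measurable_fun setT S ->
  (\int[P]_w (expR (S w))%:E <= c%:E)%E ->
  (P [set w | (a <= S w)%R] <= (c * expR (- a))%:E)%E.
Proof.
move=> mS ES.
have mexp : measurable_fun [set: O] (fun w => (expR (S w))%:E).
  by apply/measurable_EFinP; exact: measurableT_comp.
have := le_integral_abse P measurableT mexp (expR_gt0 a).
rewrite setTI (_ : [set x | _] = [set w | (a <= S w)%R]); last first.
  by apply/seteqP; split=> w /=; rewrite lee_fin ger0_norm ?expR_ge0// ler_expR.
rewrite (eq_integral (fun w => (expR (S w))%:E)); last first.
  by move=> w _; rewrite gee0_abs// lee_fin expR_ge0.
move=> /le_trans/(_ ES).
have Pfin : P [set w | (a <= S w)%R] \is a fin_num.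
  apply: fin_num_measure; rewrite -[X in measurable X]setTI.
  rewrite (_ : [set w | _] = S @^-1` `[a, +oo[%classic); first exact: mS.
  by apply/seteqP; split=> w /=; rewrite in_itv/= andbT.
move=> h; have {h} : ((expR a)%:E * P [set w | (a <= S w)%R] <= c%:E)%E := h.
rewrite -(fineK Pfin) -EFinM !lee_fin => h.
by rewrite expRN ler_pdivlMr ?expR_gt0// mulrC.
Qed.

Lemma union_bound (I : eqType) (r : seq I) (F : I -> set O) (c : R) :
  (forall i, i \in r -> measurable (F i) /\ (P (F i) <= c%:E)%E) ->
  measurable (\big[setU/set0]_(i <- r) F i) /\
  (P (\big[setU/set0]_(i <- r) F i) <= ((size r)%:R * c)%:E)%E.
Proof.
elim: r => [|i r IH] h.
  by rewrite big_nil measure0 mul0r; split.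
have [mi Pi] := h i (mem_head _ _).
have [j jr|mr Pr] := IH; first by apply: h; rewrite inE jr orbT.
rewrite big_cons; split; first exact: measurableU.
apply: (le_trans (measureU2 _ mi mr)).
by rewrite -natr1 mulrDl mul1r EFinD addeC leeD.
Qed.

End probability_bounds.

Lemma sum_expr_le {R : realFieldType} (rho : R) (n : nat) : 0 <= rho < 1 ->
  \sum_(j < n) rho ^+ j <= (1 - rho)^-1.
Proof.
move=> /andP[r0 r1]; rewrite -[leRHS]mul1r ler_pdivlMr ?subr_gt0//.
have := subrX1 rho n; have : 0 <= rho ^+ n by exact: exprn_ge0.
set s := \sum_(i < n) _ => ? ?; lra.
Qed.

(** The first [n0] terms count at most [1] each and the rest form a geometric tail. With [b n] the
    probability that [S_n <= A], this bounds the expected delay. *)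
Lemma nneseries_eventually_geometric_le {R : realType} (b : nat -> \bar R)
    (n0 : nat) (rho : R) : 0 <= rho < 1 ->
  (forall n, 0 <= b n)%E -> (forall n, b n <= 1)%E ->
  (forall j, b (n0 + j)%N <= (rho ^+ j)%:E)%E ->
  (\sum_(n <oo) b n <= (n0%:R + (1 - rho)^-1)%:E)%E.
Proof.
move=> rho01 b0 b1 brho.
apply: lime_le; first by apply: is_cvg_nneseries => n _ _; exact: b0.
apply: nearW => n.
apply: (@le_trans _ _ (\sum_(0 <= i < n0 + n) b i)%E).
  by apply: lee_sum_nneg_natr => //; exact: leq_addl.
rewrite big_mkord big_split_ord/= EFinD leeD//.
  apply: (@le_trans _ _ (\sum_(i < n0) 1%:E)%E); first exact: lee_sum.
  by rewrite sumEFin sumr_const card_ord.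
apply: (@le_trans _ _ (\sum_(i < n) (rho ^+ i)%:E)%E).
  by apply: lee_sum => i _; exact: brho.
by rewrite sumEFin lee_fin sum_expr_le.
Qed.

(** * Exponential moments of sums over independent observations *)

Section exponential_moment.
Context {R : realType} {dX dO : measure_display} {X : measurableType dX}
  {O : measurableType dO}.
Variables (mu : {measure set X -> \bar R}) (p : R -> X -> R)
  (P : probability O R) (Y : nat -> O -> X) (param : nat -> R).
Hypothesis model : obs_model mu p P Y param.
Hypothesis dens : forall k, (1 <= k)%N -> is_density mu (p (param k)).

Lemma measurable_walk (z : nat -> X -> R) (k n : nat) : (1 <= k)%N ->
  (forall i, (1 <= i)%N -> measurable_fun setT (z i)) ->
  measurable_fun setT (fun w => \sum_(k <= i < n) z i (Y i w)).
Proof.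
move=> k1 mz; have [mY _] := model.
(* Terms outside the range become [0]: [Y i] and [z i] are known to be measurable for [1 <= i]
   only. *)
under eq_fun do rewrite big_nat_cond big_mkcond.
apply: measurable_sum => i.
have [/andP[/andP[ki _] _]|_] := boolP (_ && _); last exact: measurable_cst.
have i1 := leq_trans k1 ki.
by apply: measurableT_comp; [exact: mz|exact: mY].
Qed.

(** Independence turns the moment into a product of [n - k] one-step integrals. It serves with
    [rho = 1] under no change and with the affinity bound under change at time [1]. *)
Lemma integral_expR_walk_le (z : nat -> X -> R) (rho : R) (k n : nat) :
  0 <= rho -> (1 <= k)%N ->
  (forall i, (1 <= i)%N -> measurable_fun setT (z i)) ->
  (forall i, (1 <= i)%N ->
     \int[mu]_x (p (param i) x * expR (z i x))%:E <= rho%:E)%E ->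
  (\int[P]_w (expR (\sum_(k <= i < n) z i (Y i w)))%:E <= (rho ^+ (n - k))%:E)%E.
Proof.
move=> rho0 k1 mz zrho; have [mY [indep law]] := model.
pose I i := (\int[mu]_x (p (param i) x * expR (z i x))%:E)%E.
have I0 i : (1 <= i)%N -> (0 <= I i)%E.
  move=> i1; apply: integral_ge0 => x _.
  by rewrite lee_fin mulr_ge0 ?expR_ge0//; have [_ []] := dens i i1.
have Ifin i : (1 <= i)%N -> I i \is a fin_num.
  by move=> i1; rewrite ge0_fin_numE ?I0// (le_lt_trans (zrho i i1))// ltry.
have ik i : i \in index_iota k n -> (1 <= i)%N.
  by rewrite mem_index_iota => /andP[ki _]; exact: leq_trans ki.
under eq_integral do rewrite expR_sum.
rewrite (indep_obs_integral_prod P Y mu (fun i => p (param i))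
  (fun i x => expR (z i x)) (fun i => fine (I i)))//.
- rewrite lee_fin big_seq.
  apply: (@le_trans _ _ (\prod_(i <- index_iota k n | i \in index_iota k n) rho)).
    apply: ler_prod => i /ik i1; rewrite fine_ge0 ?I0//=.
    by rewrite -lee_fin fineK ?Ifin//; exact: zrho.
  by rewrite -big_seq prodr_const_nat.
- by move=> i i1; have [] := dens i i1.
- by move=> i i1; apply: measurableT_comp => //; exact: mz.
- by move=> i x i1; have [_ []] := dens i i1.
- by move=> i i1; rewrite fineK// Ifin.
- exact: iota_uniq.
- by apply/allP => i /ik.
Qed.

End exponential_moment.

(** * Pathwise bounds on the stopping time *)

Section stopping_time.
Context {R : realType} {X : Type}.
Variables (p : R -> X -> R) (Theta : set R) (T E : nat) (N : nat -> nat)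
  (theta : nat -> R) (eps : R).
Local Notation W := (Wstat p Theta T E N theta eps).
Local Notation tauA := (tau p Theta T E N theta eps).

(** These are the sums whose supremum over [k] and [lam] defines [Wstat]. The end [n] is included,
    so [walk lam y 1 0] is the empty sum. *)
Definition walk (lam : nat -> R) (y : nat -> X) (k n : nat) : R :=
  \sum_(k <= i < n.+1)
    llr p (lam (batch T E N i)) (theta (batch T E N i)) (y i).

Lemma tau_ge0 (A : R) (y : nat -> X) : (0 <= tauA A y)%E.
Proof. by apply: le_ereal_inf_tmp => _ [n _ <-]; rewrite lee_fin. Qed.

Lemma le_tau (A : R) (y : nat -> X) (n : nat) :
  (forall k m lam, (1 <= k <= m)%N -> (m <= n)%N ->
     (forall e, (1 <= e <= E)%N -> Lambda Theta theta eps e (lam e)) ->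
     walk lam y k m <= A) ->
  (n%:R%:E <= tauA A y)%E.
Proof.
move=> h; apply: le_ereal_inf_tmp => _ [m [m1 AW] <-]; rewrite lee_fin ler_nat.
rewrite leqNgt; apply/negP => mn; move: AW; rewrite ltNge => /negP; apply.
apply: ge_ereal_sup => _ [[k lam] [/= km lamP] <-].
by rewrite lee_fin; apply: h => //; exact: ltnW.
Qed.

(** If the walk first exceeds [A] at [m], the terms of index [0] to [m - 1] all equal [1], while
    [tau] is at most [m]. If it never does, the series diverges. *)
Lemma tau_le_nneseries (A : R) (lam : nat -> R) (y : nat -> X) : 0 <= A ->
  (forall e, (1 <= e <= E)%N -> Lambda Theta theta eps e (lam e)) ->
  (tauA A y <= \sum_(n <oo) (((walk lam y 1 n <= A)%R : nat)%:R%:E))%E.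
Proof.
move=> A0 lamP.
pose d (n : nat) : \bar R := (((walk lam y 1 n <= A)%R : nat)%:R%:E).
suff : (tauA A y <= \sum_(n <oo) d n)%E by [].
have d0 n : (0 <= d n)%E by rewrite lee_fin.
have le_d n : (forall m, (m < n)%N -> walk lam y 1 m <= A) ->
    (n%:R%:E <= \sum_(n <oo) d n)%E.
  move=> h; apply: le_trans (nneseries_lim_ge n _); last by move=> *.
  rewrite big_mkord (eq_bigr (fun=> 1%:E)).
    by rewrite sumEFin sumr_const card_ord.
  by move=> i _; rewrite /d h.
have [[n hn]|/forallNP hn] := pselect (exists n, A < walk lam y 1 n).
  have ex : exists n, A < walk lam y 1 n by exists n.
  case: (ex_minnP ex) => m hm mmin {n hn ex}.
  (* The empty sum at [0] cannot exceed [A >= 0], so the passage occurs at a time admissible for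
     [tau]. *)
  have m1 : (1 <= m)%N.
    case: m hm {mmin} => //; rewrite /walk big_geq// => A_lt0.
    by move: (le_lt_trans A0 A_lt0); rewrite ltxx.
  apply: (@le_trans _ _ m%:R%:E); last first.
    apply: le_d => j jm; rewrite leNgt; apply/negP => /mmin.
    by rewrite leqNgt jm.
  (* [Wstat] at [m] dominates the walk along [lam] started at [1]. *)
  apply: ereal_inf_lbound; exists m => //; split=> //.
  apply: (@lt_le_trans _ _ (walk lam y 1 m)%:E); first by rewrite lte_fin.
  by apply: ereal_sup_ubound; exists (1%N, lam) => //; split=> //=; rewrite leqnn m1.
rewrite (_ : \sum_(n <oo) d n = +oo)%E ?leey//.
apply/eqyP => r r0.
apply: (@le_trans _ _ (Num.truncn r).+1%:R%:E).
  by rewrite lee_fin ltW// truncnS_gt.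
by apply: le_d => m _; rewrite leNgt; exact/negP.
Qed.

End stopping_time.

(** * Bounds on the expected stopping time *)

Section expected_delay.
Context {R : realType} {dX dO : measure_display} {X : measurableType dX}
  {O : measurableType dO}.
Variables (mu : {measure set X -> \bar R}) (Theta : set R) (p : R -> X -> R).
Hypothesis Hdens : forall th, Theta th -> is_density mu (p th).
Variables (T E : nat) (N : nat -> nat).
Hypotheses (HT : (0 < T)%N) (HN0 : N 0%N = 0%N) (HNE : N E = T).
Variables (theta : nat -> R) (eps : R).
Hypothesis Htheta : forall e, (1 <= e <= E)%N -> Theta (theta e).
Variables (P : probability O R) (Y : nat -> O -> X).
Local Notation b := (batch T E N).
Local Notation S := (walk p T E N theta).
Local Notation tauA := (tau p Theta T E N theta eps).
Local Notation valid lam :=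
  (forall e, (1 <= e <= E)%N -> Lambda Theta theta eps e (lam e)).

Let Theta_batch k : Theta (theta (b k)).
Proof. by apply: Htheta; exact: batch_bounds. Qed.

Let Theta_valid lam k : valid lam -> Theta (lam (b k)).
Proof. by move=> lamP; have [] := lamP _ (batch_bounds T E N k HT HN0 HNE). Qed.

Let measurable_llr lam k : valid lam ->
  measurable_fun setT (llr p (lam (b k)) (theta (b k))).
Proof.
move=> lamP; have [ml _] := Hdens _ (Theta_valid _ k lamP).
have [mt [t0 _]] := Hdens _ (Theta_batch k).
exact: measurable_ln_ratio.
Qed.

Lemma expected_tau_ge (s : seq (nat -> R)) (A : R) (n : nat) :
  (forall th la, Theta th -> Theta la -> th != la ->
     {ae mu, forall x, 0 < p th x -> 0 < p la x}) ->
  0 < eps -> obs_model mu p P Y (fun k => theta (b k)) ->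
  (forall l, l \in s -> valid l) ->
  (forall l, valid l ->
    exists2 l', l' \in s & forall e, (1 <= e <= E)%N -> l' e = l e) ->
  ((n%:R * (1 - (n * n * size s)%:R * expR (- A)))%:E <=
    \int[P]_w tauA A (fun k => Y k w))%E.
Proof.
move=> abscont eps0 model sP Ps.
(* Triples of a start, an end and a selection. When the end precedes the start the sum is empty, and
   the bound on [F] still holds. *)
pose r := [seq (kn, l) | kn <- [seq (k, m) | k <- iota 1 n, m <- iota 1 n], l <- s].
pose F (i : nat * nat * (nat -> R)) :=
  [set w | (A <= S i.2 (fun k => Y k w) i.1.1 i.1.2)%R].
have rF i : i \in r -> measurable (F i) /\ (P (F i) <= (expR (- A))%:E)%E.
  case/allpairsP => -[[k m] l] [/allpairsP[[k' m'] [/= kn mn [-> ->]]] /= ls ->] {i}.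
  have k1 : (1 <= k')%N by move: kn; rewrite mem_iota => /andP[].
  have lP := sP _ ls.
  pose z i := llr p (l (b i)) (theta (b i)).
  have mz i : (1 <= i)%N -> measurable_fun setT (z i) by move=> _; exact: measurable_llr.
  have mS : measurable_fun setT (fun w => S l (fun k => Y k w) k' m').
    exact: (measurable_walk mu p P Y _ model z).
  split.
    rewrite -[X in measurable X]setTI /F /=.
    rewrite (_ : [set w | _] = (fun w => S l (fun k => Y k w) k' m') @^-1` `[A, +oo[%classic).
      exact: mS.
    by apply/seteqP; split=> w /=; rewrite in_itv/= andbT.
  rewrite -[expR (- A)]mul1r; apply: chernoff_bound => //.
  (* One-step moments are at most [1], so the moment bound is used with [rho = 1]. *)
  rewrite -(expr1n R (m'.+1 - k')).
  apply: (integral_expR_walk_le mu p P Y (fun k => theta (b k)) model _ z) => //.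
    by move=> i _; exact: Hdens.
  move=> i _; apply: integral_expR_ln_ratio_le1.
  - exact: Hdens.
  - exact/Hdens/Theta_valid.
  - apply: abscont => //; first exact: Theta_valid.
    have [_] := lP _ (batch_bounds T E N i HT HN0 HNE).
    by apply: contraTN => /eqP ->; rewrite subrr normr0 -ltNge.
have [mBad PBad] := union_bound P _ r F _ rF.
set Bad := \big[setU/set0]_(i <- r) F i in mBad PBad.
have size_r : size r = (n * n * size s)%N by rewrite !size_allpairs !size_iota.
(* Off [Bad] no sum ending by time [n] exceeds [A], so [n] times the indicator of the complement
   lies below [tau]. *)
apply: (@le_trans _ _ (\int[P]_w (n%:R * \1_(~` Bad) w)%:E)%E).
  under eq_integral do rewrite EFinM.
  rewrite ge0_integralZl//; last first.
    by apply/measurable_EFinP; apply: measurable_indic; exact: measurableC.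
  rewrite integral_indic; [|exact: measurableT|exact: measurableC].
  have PBfin : P Bad \is a fin_num by exact: fin_num_measure.
  rewrite setIT [X in (_ * X)%E](_ : _ = 1 - P Bad)%E; last exact: probability_setC.
  rewrite -(fineK PBfin) -EFinB -EFinM lee_fin ler_wpM2l// lerB//.
  by rewrite -lee_fin fineK// -size_r.
apply: ge0_le_integral_nonmeasurable => w.
  by rewrite lee_fin mulr_ge0// indicE.
rewrite indicE; have [/set_mem nBad|_] := boolP (w \in _); last first.
  by rewrite mulr0 tau_ge0.
rewrite mulr1; apply: le_tau => k m lam /andP[k1 km] mn lamP.
(* [walk] reads [lam] at batches in [1..E] only, so a representative in [s] has the same sums. *)
have [l ls llam] := Ps _ lamP.
rewrite leNgt; apply/negP => AS; apply: nBad; rewrite /Bad -bigcup_seq.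
exists (k, m, l).
  apply/allpairsP; exists ((k, m), l); split=> //=.
  apply/allpairsP; exists (k, m); rewrite /= !mem_iota k1 !add1n !ltnS mn.
  by rewrite (leq_trans km mn) (leq_trans k1 km).
rewrite /F /= (_ : S l _ _ _ = S lam (fun k => Y k w) k m) ?ltW//.
by apply: eq_bigr => i _; rewrite llam//; exact: batch_bounds.
Qed.

(** From [n0] on, the tail bound [expR (A / 2) * rho ^+ n] is at most [rho ^+ (n - n0)], so the
    delay is [n0] plus a geometric remainder. *)
Lemma expected_tau_le (lam : nat -> R) (A rho : R) (n0 : nat) :
  obs_model mu p P Y (change_param T E N theta lam 1) -> valid lam ->
  0 <= A -> 0 <= rho < 1 ->
  (forall e, (1 <= e <= E)%N ->
    \int[mu]_x (p (lam e) x * expR (- (llr p (lam e) (theta e) x / 2)))%:E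
      <= rho%:E)%E ->
  expR (A / 2) * rho ^+ n0 <= 1 ->
  (\int[P]_w tauA A (fun k => Y k w) <= (n0%:R + (1 - rho)^-1)%:E)%E.
Proof.
move=> model lamP A0 rho01 affin n0P.
have rho0 : 0 <= rho by case/andP: rho01.
have paramE i : (1 <= i)%N -> change_param T E N theta lam 1 i = lam (b i).
  by move=> i1; rewrite /change_param ltnNge i1.
(* The factor [- 1 / 2] turns the one-step moment into a Hellinger affinity, and the event [S <= A]
   into [- (A / 2) <= Z]. *)
pose z i x := - (llr p (lam (b i)) (theta (b i)) x / 2).
have mz i : (1 <= i)%N -> measurable_fun setT (z i).
  move=> _; apply: measurableT_comp => //; apply: measurable_funM => //.
  exact: measurable_llr.
pose Z n w := \sum_(1 <= i < n.+1) z i (Y i w).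
have ZS n w : Z n w = - (S lam (fun k => Y k w) 1 n / 2).
  by rewrite /Z /z sumrN -mulr_suml.
have mZ n : measurable_fun setT (Z n) by exact: (measurable_walk mu p P Y _ model z).
have SZ n : [set w | (S lam (fun k => Y k w) 1 n <= A)%R] =
    [set w | (- (A / 2) <= Z n w)%R].
  by apply/seteqP; split=> w /=; rewrite ZS lerN2 ler_pM2r// invr_gt0.
have mSA n : measurable [set w | (S lam (fun k => Y k w) 1 n <= A)%R].
  rewrite SZ -[X in measurable X]setTI.
  rewrite (_ : [set w | _] = Z n @^-1` `[- (A / 2), +oo[%classic); first exact: mZ.
  by apply/seteqP; split=> w /=; rewrite in_itv/= andbT.
have PSA n : (P [set w | (S lam (fun k => Y k w) 1 n <= A)%R] <=
    (rho ^+ n * expR (A / 2))%:E)%E.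
  rewrite SZ -[X in expR X]opprK; apply: chernoff_bound => //.
  rewrite (_ : rho ^+ n = rho ^+ (n.+1 - 1)); last by rewrite subn1.
  apply: (integral_expR_walk_le mu p P Y (change_param T E N theta lam 1) model _ z) => //.
    by move=> i i1; rewrite paramE//; exact/Hdens/Theta_valid.
  by move=> i i1; rewrite paramE//; apply: affin; exact: batch_bounds.
apply: (@le_trans _ _ (\int[P]_w \sum_(n <oo)
    (\1_[set w | (S lam (fun k => Y k w) 1 n <= A)%R] w)%:E)%E).
  apply: ge0_le_integral_nonmeasurable => w; first exact: tau_ge0.
  apply: le_trans (tau_le_nneseries _ _ _ _ _ _ _ A lam _ A0 lamP) _.
  apply: lee_nneseries => [n _|n _]; first by rewrite lee_fin.
  by rewrite lee_fin indicE mem_setE.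
rewrite integral_nneseries//; last first.
  by move=> n; apply/measurable_EFinP; exact: measurable_indic.
apply: nneseries_eventually_geometric_le => // [n|n|j].
- by apply: integral_ge0 => w _; rewrite lee_fin indicE.
- by rewrite integral_indic// setIT; exact: probability_le1.
rewrite integral_indic// setIT; apply: le_trans (PSA _) _.
rewrite lee_fin exprD mulrAC [rho ^+ n0 * _]mulrC.
by apply: ler_piMl => //; exact: exprn_ge0.
Qed.

End expected_delay.

(** * Choice of the threshold and of the constants *)

Lemma uniform_lt1 {R : realType} (I : eqType) (r : seq I) (f : I -> \bar R) :
  (forall i, i \in r -> f i < 1)%E ->
  exists2 rho : R, 0 < rho < 1 & (forall i, i \in r -> f i <= rho%:E)%E.
Proof.
(* Starting from [2^-1] keeps [rho] positive, as [ln rho] is taken later. *)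
elim: r => [_|i r IH h]; first by exists 2^-1 => //; lra.
have [j jr|rho /andP[rho0 rho1] hrho] := IH; first by apply: h; rewrite inE jr orbT.
exists (Num.max rho (fine (f i))).
  rewrite lt_max rho0 gt_max rho1 /=.
  by move: (h i (mem_head _ _)); case: (f i) => [x||]//=; rewrite lte_fin.
move=> j; rewrite inE => /predU1P[->|/hrho /le_trans]; last first.
  by apply; rewrite lee_fin le_max lexx.
by move: (h i (mem_head _ _)); case: (f i) => [x||]//= _;
  rewrite ?leNye// lee_fin le_max lexx orbT.
Qed.

Theorem theorem2 (R : realType) (dX : measure_display) (X : measurableType dX)
    (mu : {measure set X -> \bar R}) (Theta : set R) (p : R -> X -> R)
    (Hdens : forall th, Theta th -> is_density mu (p th))
    (HKL : forall th la, Theta th -> Theta la -> th != la ->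
             KL_finite_pos mu (p th) (p la))
    (T E : nat) (N : nat -> nat)
    (HT : (0 < T)%N) (HN0 : N 0%N = 0%N) (HNE : N E = T)
    (HNinc : forall e, (e < E)%N -> (N e < N e.+1)%N)
    (theta : nat -> R) (Htheta : forall e, (1 <= e <= E)%N -> Theta (theta e))
    (eps : R) (Heps : 0 < eps)
    (Hfin : forall e, (1 <= e <= E)%N -> finite_set (Lambda Theta theta eps e)) :
  exists A : R -> R,
    (exists K : R, exists b0 : R, forall beta, b0 < beta ->
        0 < A beta /\ A beta <= K * ln beta) /\
    (* E_infty[tau] >= beta (1 + o(1)) *)
    (forall (dO : measure_display) (O : measurableType dO)
            (P : probability O R) (Y : nat -> O -> X),
       obs_model mu p P Y (fun k => theta (batch T E N k)) ->
       forall delta : R, 0 < delta -> exists b0 : R, forall beta, b0 < beta ->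
         ((beta * (1 - delta))%:E <=
            \int[P]_w tau p Theta T E N theta eps (A beta) (fun k => Y k w))%E) /\
    (* E_1[tau] <= C log beta (1 + o(1)) *)
    (exists C : R, 0 < C /\
      forall lam : nat -> R,
        (forall e, (1 <= e <= E)%N -> Lambda Theta theta eps e (lam e)) ->
      forall (dO : measure_display) (O : measurableType dO)
             (P : probability O R) (Y : nat -> O -> X),
       obs_model mu p P Y (change_param T E N theta lam 1) ->
       forall delta : R, 0 < delta -> exists b0 : R, forall beta, b0 < beta ->
         (\int[P]_w tau p Theta T E N theta eps (A beta) (fun k => Y k w) <=
            (C * ln beta * (1 + delta))%:E)%E).
Proof.
(* [s] and [rho] are obtained before any [lam] or probability space is given, so [A] and [C] are
   uniform in both. *)
have [s [sP Ps]] := finite_selections _ _ _ Hfin.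
pose M : R := (size s)%:R.
have M0 : 0 <= M by rewrite ler0n.
pose aff (le : (nat -> R) * nat) : \bar R := (\int[mu]_x
  (p (le.1 le.2) x * expR (- (llr p (le.1 le.2) (theta le.2) x / 2)))%:E)%E.
have [rho /andP[rho0 rho1] affin] : exists2 rho : R, 0 < rho < 1 &
    (forall le, le \in [seq (l, e) | l <- s, e <- iota 1 E] ->
      aff le <= rho%:E)%E.
  apply: uniform_lt1 => le /allpairsP[[l e] [/= ls]].
  rewrite mem_iota add1n ltnS => eE -> {le}; rewrite /aff /=.
  have [Tl leps] := sP _ ls _ eE; have Tt := Htheta _ eE.
  apply: integral_expR_half_ln_ratio_lt1; [exact: Hdens|exact: Hdens|].
  apply: HKL => //.
  by apply: contraTN leps => /eqP ->; rewrite subrr normr0 -ltNge.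
have lnrho : ln rho < 0 by rewrite ln_lt0// rho0.
(* With [A = 3 ln beta], the condition [expR (A / 2) * rho ^+ n <= 1] amounts to
   [C * ln beta <= n]. *)
pose C := 3 / (2 * - ln rho).
have C0 : 0 < C by rewrite divr_gt0// mulr_gt0// oppr_gt0.
exists (fun beta => 3 * ln beta); split; [|split].
- exists 3, 1 => beta beta1; split; last by [].
  by rewrite mulr_gt0// ln_gt0.
- move=> dO O P Y model delta delta0.
  (* [1 < beta] gives [n <= 2 * beta]. The other two bounds make the error [4 * M / beta] at most
     [1], so that the factors compared at the end are nonnegative, and at most [delta]. *)
  exists (Num.max 1 (Num.max (4 * M) (4 * M / delta))) => beta.
  rewrite !gt_max => /and3P[beta1 betaM betaMd].
  have beta0 : 0 < beta by exact: lt_trans beta1.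
  set n := (Num.truncn beta).+1.
  have nbeta : beta <= n%:R by rewrite ltW// truncnS_gt.
  have n2beta : n%:R <= 2 * beta.
    have := truncn_le beta; rewrite /n -natr1; lra.
  apply: le_trans (expected_tau_ge _ _ _ Hdens _ _ _ HT HN0 HNE _ _ Htheta _ _
    s _ n _ Heps model sP Ps); last first.
    by move=> th la Tth Tla ne; have [] := HKL _ _ Tth Tla ne.
  rewrite lee_fin.
  have -> : expR (- (3 * ln beta)) = (beta ^+ 3)^-1.
    by rewrite expRN expRM_natl lnK ?posrE.
  have union_le : (n * n * size s)%:R * (beta ^+ 3)^-1 <= 4 * M / beta.
    rewrite ler_pdivrMr ?exprn_gt0// natrM -/M.
    have -> : 4 * M / beta * beta ^+ 3 = (2 * beta) * (2 * beta) * M.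
      by field; rewrite gt_eqF.
    by rewrite natrM ler_wpM2r// ler_pM.
  have le1 : 4 * M / beta <= 1 by rewrite ler_pdivrMr// mul1r ltW.
  have led : 4 * M / beta <= delta.
    by rewrite ler_pdivrMr// [delta * _]mulrC -ler_pdivrMr// ltW.
  apply: (@le_trans _ _ (beta * (1 - 4 * M / beta))).
    by rewrite (ler_wpM2l (ltW beta0))// lerB.
  by apply: ler_pM; rewrite ?subr_ge0 ?(ltW beta0)// lerB.
(* The extra [1] absorbs the remainder [1 + (1 - rho)^-1], which [ln beta] exceeds for [beta] past
   the bound chosen below. *)
- exists (C + 1); split; first by rewrite addr_gt0.
  move=> lam lamP dO O P Y model delta delta0.
  exists (expR (1 + (1 - rho)^-1)) => beta betab.
  have beta0 : 0 < beta by exact: lt_trans (expR_gt0 _) betab.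
  have lnb : 1 + (1 - rho)^-1 < ln beta by rewrite -ltr_expR lnK ?posrE.
  have inv0 : 0 < (1 - rho)^-1 by rewrite invr_gt0 subr_gt0.
  have lnb0 : 0 < ln beta by lra.
  set n0 := (Num.truncn (C * ln beta)).+1.
  have n0_ge : C * ln beta <= n0%:R by rewrite ltW// truncnS_gt.
  have n0_le : n0%:R <= C * ln beta + 1.
    rewrite /n0 -natr1 lerD2r truncn_le//.
    by rewrite mulr_ge0 ?ltW.
  have n0P : expR (3 * ln beta / 2) * rho ^+ n0 <= 1.
    rewrite -[rho in rho ^+ _]lnK ?posrE// -expRM_natl -expRD expR_le1.
    have : C * ln beta * - ln rho = 3 * ln beta / 2.
      by rewrite /C; field; rewrite lt_eqF.
    (* Multiply [C * ln beta <= n0] by [- ln rho > 0]. *)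
    nra.
  apply: le_trans (expected_tau_le _ _ _ Hdens _ _ _ HT HN0 HNE _ _ Htheta _ _
    lam _ rho n0 model lamP _ _ _ n0P) _.
  + by rewrite mulr_ge0 ?ltW.
  + by rewrite rho1 ltW.
  + move=> e eE; have [l ls llam] := Ps _ lamP; rewrite -(llam _ eE).
    apply: (affin (l, e)); apply/allpairsP; exists (l, e).
    by rewrite /= mem_iota add1n ltnS.
  rewrite lee_fin.
  apply: (@le_trans _ _ ((C + 1) * ln beta)); first lra.
  by rewrite ler_peMr ?lerDl ?ltW// mulr_gt0// addr_gt0.
Qed.
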